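(* Let $\Phi$ be the root system of a crystallographic based root datum, and let $\Gamma\subseteq\Phi$ be the canonical simple system of a root subsystem of $\Phi$, with $\Gamma$ finite and irreducible. With the finite set of primes $\mathcal{Q}$, the positive integers $N_p$ and the integers $e^{(k)}_{\alpha,p}\in\mathbb{N}$ ($p\in\mathcal{Q}$, $1\le k\le N_p$, $\alpha\in\Gamma$) defined in the context, set, for any sequence $\mathbf{k}=(k_p)_{p\in\mathcal{Q}}$ with $1\le k_p\le N_p$, \[ m_\alpha^{(\mathbf{k})}=\prod_{p\in\mathcal{Q}}p^{e_{\alpha,p}^{(k_p)}}\qquad(\alpha\in\Gamma). \] Then the scaling functions $M:\Gamma\to\mathbb{N}$ are precisely the functions of the form $M(\alpha)=n\,m_\alpha^{(\mathbf{k})}$, where $\mathbf{k}=(k_p)_{p\in\mathcal{Q}}$ is a sequence of integers with $1\le k_p\le N_p$ for all $p\in\mathcal{Q}$, and $n\in\mathbb{N}$.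
   Context: Conventions: $\mathbb{N}=\{0,1,2,\dots\}$; $a\mid b$ means $b\in a\mathbb{Z}$. Based root data. A subset $\Gamma$ of a real vector space is positively independent if $\sum_{\alpha\in\Gamma}c_\alpha\alpha=0$ with all $c_\alpha\ge 0$, almost all zero, implies all $c_\alpha=0$. A generalised Cartan matrix is a possibly infinite matrix $(c_{\alpha,\beta})_{\alpha,\beta\in\Pi}$ with $c_{\alpha,\alpha}=2$ and, for $\alpha\ne\beta$, $c_{\alpha,\beta}\in\mathbb{Z}_{\le 0}$ with $c_{\alpha,\beta}=0$ iff $c_{\beta,\alpha}=0$. A crystallographic based root datum is a tuple $B=(V,V^\vee,\Pi,\Pi^\vee,\langle-,-\rangle,\iota)$ where $V,V^\vee$ are real vector spaces, $\langle-,-\rangle:V\times V^\vee\to\mathbb{R}$ is bilinear, $\Pi\subseteq V$ and $\Pi^\vee\subseteq V^\vee$ are positively independent, and $\iota:\Pi\to\Pi^\vee$, $\alpha\mapsto\alpha^\vee$, is a bijection such that $(\langle\alpha,\beta^\vee\rangle)_{\alpha,\beta\in\Pi}$ is a generalised Cartan matrix. For $\alpha\in\Pi$ let $s_\alpha(v)=v-\langle v,\alpha^\vee\rangle\alpha$ on $V$; let $W=\langle s_\alpha\mid\alpha\in\Pi\rangle$, $\Phi=W\Pi$ (the root system), $\Phi_+=\Phi\cap\mathbb{R}_{\ge0}\Pi$. Dually, the reflections $u\mapsto u-\langle\alpha,u\rangle\alpha^\vee$ ($\alpha\in\Pi$) of $V^\vee$ generate a group canonically isomorphic to $W$, with $\Phi^\vee=W\Pi^\vee$;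 $\iota$ extends uniquely to a $W$-equivariant bijection $\Phi\to\Phi^\vee$, $\alpha\mapsto\alpha^\vee$. For $\alpha\in\Phi$, $s_\alpha(v)=v-\langle v,\alpha^\vee\rangle\alpha$. Root subsystems. A root subsystem of $\Phi$ is a subset $\Psi\subseteq\Phi$ such that $\alpha,\beta\in\Psi$ implies $s_\alpha(\beta)\in\Psi$. For $\Gamma\subseteq\Phi$, $W_\Gamma=\langle s_\alpha\mid\alpha\in\Gamma\rangle$. Every root subsystem $\Psi$ has a canonical simple system $\Gamma\subseteq\Psi$, the unique $\Gamma\subseteq\Phi_+$ with $W_\Gamma=W_\Psi$ and $\langle\alpha,\beta^\vee\rangle\le0$ for distinct $\alpha,\beta\in\Gamma$; then $(\langle\alpha,\beta^\vee\rangle)_{\alpha,\beta\in\Gamma}$ is a generalised Cartan matrix. $\Gamma$ is irreducible if it is non-empty and is not a disjoint union of two non-empty subsets $\Gamma',\Gamma''$ with $\langle\alpha,\beta^\vee\rangle=0$ for all $\alpha\in\Gamma',\beta\in\Gamma''$. Scaling functions. A scaling function on $\Gamma$ is a function $M:\Gamma\to\mathbb{N}$, $\alpha\mapsto m_\alpha$, such that $m_\beta\mid\langle\beta,\alpha^\vee\rangle m_\alpha$ for all $\alpha,\beta\in\Gamma$. The integers $e^{(k)}_{\alpha,p}$. Let $\nu_p:\mathbb{Q}\to\mathbb{Z}\cup\{\infty\}$ be the $p$-adic valuation, $\nu_p(0)=\infty$. Let $\mathcal{Q}$ be the finite set of primes $p$ dividing at least one non-zero integer $\langle\alpha,\beta^\vee\rangle$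 with $\alpha,\beta\in\Gamma$. Fix any element $\gamma\in\Gamma$. For $p\in\mathcal{Q}$, the set of functions $d:\Gamma\to\mathbb{Z}$, $\alpha\mapsto d_\alpha$, with $d_\gamma=0$ and $d_\beta\le\nu_p(\langle\beta,\alpha^\vee\rangle)+d_\alpha$ for all $\alpha,\beta\in\Gamma$ is finite and non-empty; list its elements as $\alpha\mapsto d^{(k)}_{\alpha,p}$, $k=1,\dots,N_p$. Put $d^{(k)}_p=\min\{d^{(k)}_{\alpha,p}\mid\alpha\in\Gamma\}$ and $e^{(k)}_{\alpha,p}=d^{(k)}_{\alpha,p}-d^{(k)}_p\in\mathbb{N}$. *)

(* Defs.v *)
From HB Require Import structures.
From mathcomp Require Import all_boot all_order all_algebra.
From mathcomp Require Import finmap.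
From mathcomp Require Import boolp classical_sets functions cardinality fsbigop.
From mathcomp Require Import reals constructive_ereal.

Set Implicit Arguments.
Unset Strict Implicit.
Unset Printing Implicit Defensive.

Import Order.TTheory GRing.Theory Num.Theory.

Local Open Scope classical_set_scope.
Local Open Scope ring_scope.

Section LinearAlgebra.
Variables (R : realType) (V : lmodType R).

Definition positively_independent (A : set V) : Prop :=
  forall c : V -> R,
    finite_set (A `&` [set a | c a != 0]) ->
    (forall a, A a -> 0 <= c a) ->
    \sum_(a \in A) c a *: a = 0 ->
    forall a, A a -> c a = 0.

Definition nonneg_cone (A : set V) : set V :=
  [set v | exists c : V -> R,
     [/\ finite_set (A `&` [set a | c a != 0]),
         forall a, A a -> 0 <= c a
       & v = \sum_(a \in A) c a *: a]].

Definition gen_cartan_matrix (A : set V) (c : V -> V -> R) : Prop :=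
  (forall a, A a -> c a a = 2) /\
  (forall a b, A a -> A b -> a <> b ->
     [/\ c a b \is a Num.int, c a b <= 0 & (c a b = 0 <-> c b a = 0)]).

End LinearAlgebra.

Inductive gen_group (T : Type) (S : set (T -> T)) : (T -> T) -> Prop :=
| gen_group_id : gen_group S id
| gen_group_gen f : S f -> gen_group S f
| gen_group_comp f g : gen_group S f -> gen_group S g -> gen_group S (f \o g)
| gen_group_inv f g :
    gen_group S f -> cancel f g -> cancel g f -> gen_group S g.

Record based_root_datum (R : realType) (V Vd : lmodType R) := BasedRootDatum {
  brd_simple : set V;
  brd_cosimple : set Vd;
  brd_pair : V -> Vd -> R;
  brd_iota : V -> Vd;   (* only its values on brd_simple matter *)
  brd_pair_linearl : forall u : Vd, scalar (brd_pair^~ u);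
  brd_pair_linearr : forall v : V, scalar (brd_pair v);
  brd_simple_indep : positively_independent brd_simple;
  brd_cosimple_indep : positively_independent brd_cosimple;
  brd_iota_bij : set_bij brd_simple brd_cosimple brd_iota;
  brd_cartan : gen_cartan_matrix brd_simple
                 (fun a b => brd_pair a (brd_iota b))
}.

Section RootSystem.
Variables (R : realType) (V Vd : lmodType R) (B : based_root_datum V Vd).
Local Notation Pi := (brd_simple B).
Local Notation "<< v , u >>" := (brd_pair B v u).
Local Notation iota := (brd_iota B).

Definition refl (a : V) (av : Vd) (v : V) : V := v - << v, av >> *: a.

Definition corefl (a : V) (av : Vd) (u : Vd) : Vd := u - << a, u >> *: av.

Definition Weyl : set (V -> V) :=
  gen_group [set refl a (iota a) | a in Pi].

Definition coWeyl : set (Vd -> Vd) :=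
  gen_group [set corefl a (iota a) | a in Pi].

Definition roots : set V :=
  [set v | exists w a, [/\ Weyl w, Pi a & v = w a]].

Definition coroots : set Vd :=
  [set u | exists w a, [/\ coWeyl w, brd_cosimple B a & u = w a]].

Definition pos_roots : set V := roots `&` nonneg_cone Pi.

(* [cor] is the W-equivariant bijection from roots to coroots extending iota.
   The isomorphism between the groups acting on V and Vd matches
   [refl a (iota a)] with [corefl a (iota a)], so equivariance is imposed on
   these generators. The values of [cor] outside [roots] are irrelevant. *)
Definition is_coroot_map (cor : V -> Vd) : Prop :=
  [/\ set_bij roots coroots cor,
      forall a, Pi a -> cor a = iota a
    & forall a b, Pi a -> roots b ->
        cor (refl a (iota a) b) = corefl a (iota a) (cor b)].

Lemma pair_reflE a av v u :
  << refl a av v, u >> = << v, u >> - << v, av >> * << a, u >>.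
Proof. by rewrite /refl addrC -scaleNr brd_pair_linearl mulNr addrC. Qed.

Lemma pair_coreflE a av v u :
  << v, corefl a av u >> = << v, u >> - << a, u >> * << v, av >>.
Proof. by rewrite /corefl addrC -scaleNr brd_pair_linearr mulNr addrC. Qed.

Lemma simple_pair_int a b : Pi a -> Pi b -> << a, iota b >> \is a Num.int.
Proof.
move=> Pa Pb; have [c2 cN] := brd_cartan B.
by have [->|/eqP ab] := eqVneq a b; [rewrite c2 | have [] := cN a b Pa Pb ab].
Qed.

Lemma root_coroot_int a u : roots a -> coroots u -> << a, u >> \is a Num.int.
Proof.
have inv w : coWeyl w -> forall u,
    (forall p, Pi p -> << p, u >> \is a Num.int) <->
    (forall p, Pi p -> << p, w u >> \is a Num.int).
  elim=> {w u} [//|_ [b Pb <-] u|f g _ IHf _ IHg u|f g _ IHf fK gK u].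
  - split=> H p Pp; first by rewrite pair_coreflE rpredB ?rpredM ?H ?simple_pair_int.
    have := H _ Pb; rewrite pair_coreflE (proj1 (brd_cartan B) _ Pb) => Hb.
    have {}Hb : << b, u >> \is a Num.int.
      by move: Hb; rewrite mulr_natr mulr2n opprD addNKr rpredN.
    by have := H _ Pp; rewrite pair_coreflE rpredBr // rpredM ?simple_pair_int.
  - by rewrite IHg IHf.
  - by rewrite (IHf (g u)) gK.
have simp p u' : Pi p -> coroots u' -> << p, u' >> \is a Num.int.
  move=> Pp [w [b [Ww Pb ->]]]; move: p Pp; apply/(inv w Ww b) => p Pp.
  have [_ _ surj] := brd_iota_bij B; have [b0 Pb0 <-] := surj _ Pb.
  exact: simple_pair_int.
have cosimp b : Pi b -> coroots (iota b).
  move=> Pb; exists id, (iota b); split=> //; first exact: gen_group_id.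
  by have [h _ _] := brd_iota_bij B; apply: h.
have inv2 w : Weyl w -> forall v,
    (forall u, coroots u -> << v, u >> \is a Num.int) <->
    (forall u, coroots u -> << w v, u >> \is a Num.int).
  elim=> {w} [//|_ [b Pb <-] v|f g _ IHf _ IHg v|f g _ IHf fK gK v].
  - split=> H u' Cu'.
      by rewrite pair_reflE rpredB ?rpredM ?H ?simp //; apply: cosimp.
    have := H _ (cosimp _ Pb); rewrite pair_reflE (proj1 (brd_cartan B) _ Pb) => Hb.
    have {}Hb : << v, iota b >> \is a Num.int.
      by move: Hb; rewrite mulr_natr mulr2n opprD addNKr rpredN.
    by have := H _ Cu'; rewrite pair_reflE rpredBr // rpredM // simp.
  - by rewrite IHg IHf.
  - by rewrite (IHf (g v)) gK.
move=> [w [b [Ww Pb ->]]]; move: u; apply/(inv2 w Ww b) => u' Cu'.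
exact: simp.
Qed.

Section Subsystems.
Variable cor : V -> Vd.

Definition refl_group (A : set V) : set (V -> V) :=
  gen_group [set refl a (cor a) | a in A].

Definition root_subsystem (Psi : set V) : Prop :=
  Psi `<=` roots /\
  forall a b, Psi a -> Psi b -> Psi (refl a (cor a) b).

Definition canonical_simple_system (Psi Gamma : set V) : Prop :=
  [/\ Gamma `<=` Psi, Gamma `<=` pos_roots, refl_group Gamma = refl_group Psi
    & forall a b, Gamma a -> Gamma b -> a <> b -> << a, cor b >> <= 0].

Definition irreducible (Gamma : set V) : Prop :=
  Gamma !=set0 /\
  ~ exists G1 G2 : set V,
      [/\ G1 !=set0, G2 !=set0, Gamma = G1 `|` G2, G1 `&` G2 = set0
        & forall a b, G1 a -> G2 b -> << a, cor b >> = 0].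

(* The pairing of a root with a coroot is an integer, so that the floor only
   turns an integral real number into an element of [int]. *)
Definition cartan_int (a b : V) : int := Num.floor << a, cor b >>.

Lemma cartan_intE a b : is_coroot_map cor -> roots a -> roots b ->
  (cartan_int a b)%:~R = << a, cor b >>.
Proof.
move=> [[h _ _] _ _] Ra Rb; apply: floorK.
by apply: root_coroot_int => //; apply: h.
Qed.

End Subsystems.
End RootSystem.

Definition padic_val (p : nat) (x : rat) : \bar int :=
  if x == 0 then +oo%E
  else ((logn p `|numq x|)%:Z - (logn p `|denq x|)%:Z)%:E.

Definition int_min (A : set int) : int :=
  xget 0 [set m | A m /\ forall x, A x -> m <= x].

(* Functions on Gamma are functions on the subtype of V given by Gamma. *)
Section Scaling.
Variables (R : realType) (V Vd : lmodType R) (B : based_root_datum V Vd).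
Variables (cor : V -> Vd) (Gamma : set V).
Local Notation c a b := (cartan_int B cor (val a) (val b)).

Definition scaling_function (M : Gamma -> nat) : Prop :=
  forall a b : Gamma, ((M b)%:Z %| c b a * (M a)%:Z)%Z.

Definition relevant_primes : set nat :=
  [set p | prime p /\ exists a b : Gamma, c a b != 0 /\ (p%:Z %| c a b)%Z].

Definition valuation_functions (gamma : Gamma) (p : nat) : set (Gamma -> int) :=
  [set d | d gamma = 0 /\
     forall a b : Gamma,
       ((d b)%:E <= padic_val p (c b a)%:~R + (d a)%:E)%E].

Definition normalised_exponent (d : Gamma -> int) (a : Gamma) : nat :=
  `|d a - int_min (range d)|%N.

(* [d p k] stands for the k-th function attached to the prime p, and [k p] for
   the index chosen at p. *)
Definition scaling_basis (d : nat -> nat -> Gamma -> int) (k : nat -> nat)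
    (a : Gamma) : nat :=
  \big[muln/1%N]_(p \in relevant_primes)
    (p ^ normalised_exponent (d p (k p)) a)%N.

End Scaling.

(* Main.v *)
(** Taking [p]-adic valuations, a nowhere zero [M] is a scaling function iff
    [v_p(M b) <= v_p(c b a) + v_p(M a)] for every prime [p] and all [a], [b].
    For relevant [p] this says that [a |-> v_p(M a) - v_p(M gamma)] is a
    valuation function; for the other primes it makes [v_p(M a)] constant, since
    irreducibility strongly connects the graph of the nonzero [c b a].  The same
    connectedness forces a scaling function with a zero to vanish identically. *)
Require Import Defs.
From mathcomp Require Import all_boot all_order all_algebra.
From mathcomp Require Import boolp classical_sets functions cardinality fsbigop.
From mathcomp Require Import reals.
From mathcomp Require Import finmap constructive_ereal zify.

Import Order.TTheory GRing.Theory Num.Theory.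

Local Open Scope classical_set_scope.
Local Open Scope ring_scope.

Lemma int_minP (A : set int) : finite_set A -> A !=set0 ->
  A (int_min A) /\ forall x, A x -> int_min A <= x.
Proof.
move=> /finite_seqP[s ->] [x0 /= x0s].
suff: exists m, m \in s /\ forall x, x \in s -> m <= x.
  by move=> h; have := xgetPex 0 (P := [set m | _ /\ _]) h.
elim: s x0 x0s => [//|y s IH] x0 _.
(* The induction hypothesis needs a non-empty tail, so singletons are treated apart. *)
case: s IH => [_|z s /(_ z (mem_head _ _))[m [ms mP]]].
  by exists y; split=> [|x]; rewrite inE // => /eqP ->.
have [le_ym|/ltW le_my] := leP y m.
  exists y; split=> [|x]; rewrite inE ?eqxx // => /orP[/eqP -> //|/mP].
  exact: le_trans.
exists m; split=> [|x]; rewrite inE ?ms ?orbT // => /orP[/eqP -> //|].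
exact: mP.
Qed.

(** * Divisibility and prime-power products through valuations *)

Lemma dvdn_logP (m n : nat) : (0 < m)%N -> (0 < n)%N ->
  (m %| n)%N <-> (forall p, prime p -> (logn p m <= logn p n)%N).
Proof.
move=> m0 n0; split=> [mn p _|h]; first exact: dvdn_leq_log.
apply/dvdn_partP => // p /[!mem_primes] /andP[pr_p _].
by rewrite p_part pfactor_dvdn // h.
Qed.

Lemma logn_big_prod (I : Type) (s : seq I) (F : I -> nat) (p : nat) :
  (forall i, 0 < F i)%N ->
  (logn p (\prod_(i <- s) F i) = \sum_(i <- s) logn p (F i))%N.
Proof.
(* Positivity of the partial products is carried along because [lognM] requires it. *)
move=> F0; suff [] : (0 < \prod_(i <- s) F i)%N /\
  (logn p (\prod_(i <- s) F i) = \sum_(i <- s) logn p (F i))%N by [].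
apply: (big_rec2 (fun x y => (0 < x)%N /\ logn p x = y)); first by rewrite logn1.
by move=> i x y _ [x0 <-]; rewrite muln_gt0 F0 x0 lognM ?F0.
Qed.

Section PrimePowerProduct.
Variables (Q : set nat) (finQ : finite_set Q).
Hypothesis primeQ : forall p, Q p -> prime p.
Variable e : nat -> nat.

(** The guard makes the factor positive at every index, also outside [Q], as [logn_big_prod]
    demands. *)
Let prodE : \big[muln/1%N]_(p \in Q) (p ^ e p)%N =
  (\prod_(p <- fset_set Q) (if p \in Q then p ^ e p else 1))%N.
Proof.
rewrite fsbig_finite //= [LHS]big_seq [RHS]big_seq; apply: eq_bigr => p.
by rewrite in_fset_set // => ->.
Qed.

Let factor_gt0 p : (0 < if p \in Q then p ^ e p else 1)%N.
Proof. by case: ifP => // /set_mem/primeQ pr_p; rewrite expn_gt0 prime_gt0. Qed.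

Lemma prime_power_prod_gt0 : (0 < \big[muln/1%N]_(p \in Q) (p ^ e p)%N)%N.
Proof. by rewrite prodE big_seq prodn_gt0. Qed.

Lemma logn_prime_power_prod q : prime q ->
  logn q (\big[muln/1%N]_(p \in Q) (p ^ e p)%N) = if q \in Q then e q else 0%N.
Proof.
move=> pr_q; rewrite prodE logn_big_prod //.
have logF p : logn q (if p \in Q then p ^ e p else 1)%N =
    if p == q then (if q \in Q then e q else 0)%N else 0%N.
  case: eqVneq => [->|pq]; first by case: ifP; rewrite ?pfactorK ?logn1.
  case: ifP => [/set_mem/primeQ pr_p|_]; last by rewrite logn1.
  by rewrite lognX logn_prime // eq_sym (negPf pq) muln0.
rewrite (eq_bigr _ (fun p _ => logF p)) -big_mkcond /=.
case: ifPn => [Qq|nQq]; last by rewrite big1.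
(* The index [q] occurs only once, so its term is the whole sum. *)
rewrite (big_rem q) ?in_fset_set //= eqxx big_seq_cond big1 ?addn0 // => p.
by rewrite (rem_filter _ (fset_uniq _)) mem_filter /= => /andP[/andP[/negPf->]].
Qed.

End PrimePowerProduct.

Lemma padic_val_int (p : nat) (z : int) :
  padic_val p z%:~R = if z == 0 then +oo%E else (logn p `|z|%N)%:Z%:E.
Proof. by rewrite /padic_val intr_eq0 numq_int denq_int logn1 subr0. Qed.

(** * Connectedness of [Gamma] and the valuation inequalities *)

Section Scaling.
Variables (R : realType) (V Vd : lmodType R) (B : based_root_datum V Vd).
Variables (cor : V -> Vd) (Gamma : set V).
Hypothesis hfin : finite_set Gamma.
Local Notation c a b := (cartan_int B cor (val a) (val b)).
Local Notation Q := (relevant_primes B cor Gamma).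

(** Otherwise [S] and its complement would be an orthogonal splitting of [Gamma]. This is the form
    in which irreducibility is used: a property that passes along nonzero Cartan integers holds
    everywhere once it holds somewhere. *)
Lemma irreducible_closed (S : set Gamma) : is_coroot_map B cor ->
  Gamma `<=` Defs.roots B -> irreducible B cor Gamma -> S !=set0 ->
  (forall a b : Gamma, S a -> c a b != 0 -> S b) -> forall a, S a.
Proof.
move=> hcor Groots [_ irr] S0 Scl a; apply: contrapT => nSa; apply: irr.
have imS (P : set Gamma) (x : Gamma) : (val @` P) (val x) -> P x.
  by case=> y Py /val_inj <-.
exists (val @` S), (val @` ~` S); split.
- by case: S0 => x Sx; exists (val x), x.
- by exists (val a), a.
- apply/seteqP; split=> [x Gx|x [[y _ <-]|[y _ <-]]]; try exact: set_valP.
  have [Sx|nSx] := pselect (S (SigSub (mem_set Gx))); first by left; eexists; eauto.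
  by right; eexists; eauto.
- by apply/seteqP; split=> // _ [[y Sy <-]] /imS.
- move=> _ _ [x Sx <-] [y nSy <-].
  rewrite -cartan_intE //; try exact/Groots/set_valP.
  have [->//|cxy] := eqVneq (c x y) 0.
  by case: nSy; exact: Scl cxy.
Qed.

Lemma finite_relevant_primes : finite_set Q.
Proof.
have finT : finite_set [set: Gamma] by rewrite (eq_finite_set (card_setT _)).
pose D := \bigcup_(x in [set: Gamma] `*` [set: Gamma])
  [set` primes `|c x.1 x.2|%N].
apply: (@sub_finite_set _ _ D); last first.
  by apply: bigcup_finite => [|x _]; [exact: finite_setX|exact: finite_seq].
move=> p [pr_p [a [b [cab pc]]]]; exists (a, b) => //=.
by rewrite dvdzE in pc; rewrite mem_primes pr_p absz_gt0 cab.
Qed.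

(** A zero entry has valuation [+oo] and imposes nothing, so the conditions become inequalities
    between integers. *)
Lemma valuation_functionsP (gamma : Gamma) (p : nat) (d : Gamma -> int) :
  valuation_functions B cor gamma p d <->
  d gamma = 0 /\
  forall a b : Gamma, c b a != 0 -> d b <= (logn p `|c b a|%N)%:Z + d a.
Proof.
rewrite /valuation_functions /=; split=> -[d0 h]; split=> // a b.
  by move=> cba; have := h a b; rewrite padic_val_int (negPf cba) -EFinD lee_fin.
rewrite padic_val_int; case: eqVneq => [_|cba]; first by rewrite addye // leey.
by rewrite -EFinD lee_fin h.
Qed.

Lemma scaling_functionP (M : Gamma -> nat) : (forall a, 0 < M a)%N ->
  scaling_function B cor M <->
  forall p, prime p -> forall a b : Gamma, c b a != 0 ->
    (logn p (M b) <= logn p `|c b a|%N + logn p (M a))%N.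
Proof.
move=> M0; split=> h => [p pr_p a b cba|a b].
  rewrite -lognM ?absz_gt0 //.
  have := h a b; rewrite dvdzE abszM /= => /dvdn_logP; apply=> //.
  by rewrite muln_gt0 absz_gt0 cba M0.
have [->|cba] := eqVneq (c b a) 0; first by rewrite mul0r dvdz0.
rewrite dvdzE abszM /=; apply/dvdn_logP => //.
  by rewrite muln_gt0 absz_gt0 cba M0.
by move=> p pr_p; rewrite lognM ?absz_gt0 //; exact: h.
Qed.

(** The absolute value in the definition is harmless, since no value of [d] lies below the
    minimum. *)
Lemma normalised_exponentE (d : Gamma -> int) (a : Gamma) :
  (normalised_exponent d a)%:Z = d a - int_min (range d).
Proof.
have finT : finite_set [set: Gamma] by rewrite (eq_finite_set (card_setT _)).
have [|_ dmin] := int_minP _ (finite_image d finT); first by exists (d a), a.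
by rewrite /normalised_exponent gez0_abs // subr_ge0 dmin //; exists a.
Qed.

Lemma int_min_range_attained (d : Gamma -> int) (gamma : Gamma) :
  exists a, d a = int_min (range d).
Proof.
have finT : finite_set [set: Gamma] by rewrite (eq_finite_set (card_setT _)).
by have [|[a _ ?] _] := int_minP _ (finite_image d finT);
  [exists (d gamma), gamma|exists a].
Qed.

Section Basis.
Variables (d : nat -> nat -> Gamma -> int) (k : nat -> nat).
Local Notation m := (scaling_basis B cor d k).

Lemma scaling_basis_gt0 a : (0 < m a)%N.
Proof.
by apply: prime_power_prod_gt0; [exact: finite_relevant_primes|move=> p []].
Qed.

Lemma logn_scaling_basis p a : prime p ->
  logn p (m a) = if p \in Q then normalised_exponent (d p (k p)) a else 0%N.
Proof.
by apply: logn_prime_power_prod; [exact: finite_relevant_primes|move=> q []].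
Qed.

(** The valuation inequalities survive subtracting a constant from [d], here its minimum; at
    irrelevant primes all exponents are 0. *)
Lemma scaling_basis_scaling (gamma : Gamma) :
  (forall p, Q p -> valuation_functions B cor gamma p (d p (k p))) ->
  scaling_function B cor m.
Proof.
move=> hk; apply/scaling_functionP; first exact: scaling_basis_gt0.
move=> p pr_p a b cba; rewrite !logn_scaling_basis //.
case: ifP => // /set_mem/hk/valuation_functionsP[_ /(_ a b cba)].
by rewrite -lez_nat PoszD !normalised_exponentE; lia.
Qed.

(** The factor is the quotient of the values at [gamma]; at each prime, [M] and the basis function
    have exponents differing by a constant. *)
Lemma scaling_basis_proportional (gamma : Gamma) (M : Gamma -> nat) :
  (forall a, 0 < M a)%N ->
  (forall p a, prime p -> Q p ->
     d p (k p) a = (logn p (M a))%:Z - (logn p (M gamma))%:Z) ->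
  (forall p a, prime p -> ~ Q p -> logn p (M a) = logn p (M gamma)) ->
  exists n, forall a, M a = (n * m a)%N.
Proof.
move=> M0 dM cM; have m0 := scaling_basis_gt0.
have m_dvd : (m gamma %| M gamma)%N.
  apply/dvdn_logP => // p pr_p; rewrite logn_scaling_basis //.
  case: ifP => // /set_mem Qp; rewrite -lez_nat normalised_exponentE.
  (* With the minimum attained at [b], the exponent at [gamma] is
     [logn p (M gamma) - logn p (M b)]. *)
  have [b <-] := int_min_range_attained (d p (k p)) gamma.
  by rewrite !dM //; lia.
have n0 : (0 < M gamma %/ m gamma)%N by rewrite divn_gt0 ?m0 ?(dvdn_leq (M0 _) m_dvd).
exists (M gamma %/ m gamma)%N => a; apply: eqn_from_log => //.
  by rewrite muln_gt0 n0 m0.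
move=> p; have [pr_p|npr_p] := boolP (prime p); last by rewrite /logn (negPf npr_p).
rewrite lognM //.
have: logn p (M gamma) = (logn p (M gamma %/ m gamma) + logn p (m gamma))%N.
  by rewrite -lognM // divnK.
rewrite !logn_scaling_basis //; case: ifPn => [/set_mem Qp|nQp]; last first.
  by rewrite (cM p a) // => Qp; rewrite mem_set in nQp.
(* The minimum cancels between the exponents at [a] and at [gamma]. *)
have := normalised_exponentE (d p (k p)) a.
have := normalised_exponentE (d p (k p)) gamma.
by rewrite !dM //; lia.
Qed.

End Basis.

(** If [M x = 0] then 0 divides [c x y * M y], so zeros propagate along nonzero [c x y]. *)
Lemma scaling_eq0 (M : Gamma -> nat) (a : Gamma) : is_coroot_map B cor ->
  Gamma `<=` Defs.roots B -> irreducible B cor Gamma ->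
  scaling_function B cor M -> M a = 0%N -> forall b, M b = 0%N.
Proof.
move=> hcor Groots irr hM Ma b.
apply: (@irreducible_closed [set x | M x = 0%N]) => //; first by exists a.
move=> x y /= Mx cxy; have := hM y x.
by rewrite Mx dvd0z mulf_eq0 (negPf cxy) /= => /eqP[].
Qed.

(** An irrelevant prime divides no nonzero Cartan integer, so its exponent in [M] cannot decrease
    along nonzero entries; connectedness in both directions gives equality. *)
Lemma scaling_logn_irrelevant (M : Gamma -> nat) (p : nat) :
  is_coroot_map B cor -> Gamma `<=` Defs.roots B -> irreducible B cor Gamma ->
  (forall a, 0 < M a)%N -> scaling_function B cor M -> prime p -> ~ Q p ->
  forall a b, logn p (M a) = logn p (M b).
Proof.
move=> hcor Groots irr M0 /(scaling_functionP _ M0) hM pr_p nQp.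
suff le a b : (logn p (M a) <= logn p (M b))%N.
  by move=> a b; apply/eqP; rewrite eqn_leq !le.
apply: (@irreducible_closed [set x | logn p (M a) <= logn p (M x)]%N) => //.
  by exists a => /=.
move=> x y /= ax cxy; apply: (leq_trans ax).
have := hM p pr_p y x cxy; rewrite [X in (X + _)%N](_ : _ = 0%N) //.
apply/eqP; rewrite -leqn0 leqNgt logn_gt0; apply: contra_notN nQp.
rewrite mem_primes => /and3P[_ _ pc].
by split=> //; exists x, y; rewrite dvdzE.
Qed.

End Scaling.

Theorem proposition28 (R : realType) (V Vd : lmodType R)
    (B : based_root_datum V Vd) (cor : V -> Vd) (hcor : is_coroot_map B cor)
    (Psi Gamma : set V)
    (hPsi : root_subsystem B cor Psi)
    (hGamma : canonical_simple_system B cor Psi Gamma)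
    (hfin : finite_set Gamma) (hirr : irreducible B cor Gamma)
    (gamma : Gamma) (N : nat -> nat) (d : nat -> nat -> Gamma -> int)
    (hd : forall p, relevant_primes B cor Gamma p ->
       set_bij [set k | (1 <= k <= N p)%N]
               (valuation_functions B cor gamma p) (d p))
    (M : Gamma -> nat) :
  scaling_function B cor M <->
  exists (n : nat) (k : nat -> nat),
    (forall p, relevant_primes B cor Gamma p -> (1 <= k p <= N p)%N) /\
    (forall a : Gamma, M a = (n * scaling_basis B cor d k a)%N).
Proof.
have Groots : Gamma `<=` Defs.roots B.
  by case: hGamma => _ Gpos _ _ a /Gpos[].
split=> [hM|[n [k [hk MP]]] a b]; last first.
  rewrite !MP !PoszM mulrCA; apply: dvdz_mul; first exact: dvdzz.
  apply: (scaling_basis_scaling _ _ _ _ _ _ hfin d k gamma) => // p Qp.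
  by have [h _ _] := hd p Qp; exact/h/hk.
(* Surjectivity of each enumeration [d p] turns a family of valuation functions into a sequence of
   indices. *)
have index (D : nat -> Gamma -> int) :
    (forall p, relevant_primes B cor Gamma p ->
       valuation_functions B cor gamma p (D p)) ->
    exists k : nat -> nat, forall p, relevant_primes B cor Gamma p ->
      (1 <= k p <= N p)%N /\ d p (k p) = D p.
  move=> hD; suff [k kP] : {k : nat -> nat & forall p,
      relevant_primes B cor Gamma p -> (1 <= k p <= N p)%N /\ d p (k p) = D p}.
    by exists k.
  apply: (@choice _ _ (fun p j => relevant_primes B cor Gamma p ->
      (1 <= j <= N p)%N /\ d p j = D p)) => p.
  have [Qp|nQp] := pselect (relevant_primes B cor Gamma p); last by exists 0%N.
  by have [_ _ /(_ _ (hD p Qp))[j jN dj]] := hd p Qp; exists j.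
have [[a Ma]|M0] := pselect (exists a, M a = 0%N).
  (* Here [M] vanishes and [n] is 0, but an admissible [k] is still owed; the zero valuation
     function supplies one. *)
  have [p Qp|k kP] := index (fun=> fun=> 0).
    by apply/valuation_functionsP; split.
  exists 0%N, k; split=> [p /kP[]//|b].
  by rewrite mul0n; exact: (scaling_eq0 _ _ _ _ _ _ _ _ hcor Groots hirr hM Ma).
have {}M0 a : (0 < M a)%N by rewrite lt0n; apply/eqP => Ma; apply: M0; exists a.
(* The exponents of [M] are shifted to vanish at [gamma], as valuation functions must. *)
have [p [pr_p _]|k kP] := index (fun p a =>
    (logn p (M a))%:Z - (logn p (M gamma))%:Z).
  apply/valuation_functionsP; split=> [|a b cba]; first by rewrite subrr.
  by have := proj1 (scaling_functionP _ _ _ _ _ _ _ M0) hM p pr_p a b cba; lia.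
have [n nP] : exists n, forall a, M a = (n * scaling_basis B cor d k a)%N.
  apply: (scaling_basis_proportional _ _ _ _ _ _ hfin d k gamma M M0).
    by move=> p a _ /kP[_ ->].
  move=> p a pr_p nQp.
  exact: (scaling_logn_irrelevant _ _ _ _ _ _ _ _ hcor Groots hirr M0 hM).
by exists n, k; split=> // p /kP[].
Qed.
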